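(* Let $n\ge 0$ and $t\ge 0$ be integers. Then the following hold. (i) If $p$ is a prime with $p\equiv 2\pmod 3$ and $j$ is an even integer with $p\nmid j$, then $$B_3^{(12)}\left(6p^{2t+2}n+\left(p^{2t+1}(4p+3j)-1\right)\right)\equiv 0\pmod 6.$$ (ii) If $p\neq 5$ is a prime with $p\equiv 2\pmod 3$ and $j$ is an even integer with $p\nmid j$, then $$B_5^{(10)}\left(10p^{2t+2}n+\frac{5\left(p^{2t+1}(4p+3j)-1\right)}{3}\right)\equiv 0\pmod{10}.$$ (iii) If $\alpha\in\{1,2,3,4\}$, $p\neq 3$ is a prime with $p\equiv 3\pmod 4$, and $j$ is an integer with $5\mid j$ and $p\nmid j$, then $$B_3^{(15)}\left(15p^{2t+2}n+\frac{p^{2t+1}\left((12\alpha+5)p+12j\right)-5}{4}\right)\equiv 0\pmod{15}.$$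
   Context: For positive integers $\ell,r$ and an integer $n\ge 0$, $B_\ell^{(r)}(n)$ denotes the number of $\ell$-regular $r$-multipartitions of $n$, i.e. ordered $r$-tuples $(\lambda^{(1)},\dots,\lambda^{(r)})$ of (possibly empty) integer partitions, each having no part divisible by $\ell$, whose sizes sum to $n$; $B_\ell^{(r)}(0)=1$. Equivalently, as formal power series, $$\sum_{n=0}^\infty B_\ell^{(r)}(n)q^n=\frac{E_\ell^r}{E_1^r},\qquad E_k:=\prod_{m=1}^\infty(1-q^{km}).$$ By convention $B_\ell^{(r)}(m)=0$ for negative integers $m$. *)

(* Defs.v *)
From mathcomp Require Export all_boot all_order all_algebra.
Set Implicit Arguments.
Unset Strict Implicit.
Unset Printing Implicit Defensive.

Definition is_partition (s : seq nat) : bool := sorted geq s && (0 \notin s).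

Definition regular (l : nat) (s : seq nat) : bool :=
  all (fun k => ~~ (l %| k)) s.

(* A partition of size at most n has at most n parts, each at most n (see
   partition_fits), so it is a sequence of type n.-bseq 'I_n.+1: no multipartition
   of n is lost by counting inside this finite type. *)
Definition parts (n : nat) (s : n.-bseq 'I_n.+1) : seq nat := map val s.

Lemma partition_fits (n : nat) (s : seq nat) :
  is_partition s -> sumn s <= n ->
  exists! s' : n.-bseq 'I_n.+1, parts s' = s.
Proof.
move=> /andP[_ s0] sn.
have size_le : size s <= n.
  apply: leq_trans sn; elim: s s0 => //= x s IHs.
  rewrite inE negb_or eq_sym -lt0n => /andP[x0 /IHs sle].
  by rewrite -add1n leq_add.
have parts_le x : x \in s -> x < n.+1.
  move=> xs; rewrite ltnS; apply: leq_trans sn; elim: s xs {s0 size_le} => //= y s IHs.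
  rewrite inE => /orP[/eqP->|/IHs xle]; first exact: leq_addr.
  by apply: leq_trans xle _; exact: leq_addl.
have mapK : map val (map (@inord n) s) = s.
  rewrite -map_comp -[RHS]map_id; apply/eq_in_map => x /parts_le xn /=.
  exact: inordK.
have size_le' : size (map (@inord n) s) <= n by rewrite size_map.
exists (Bseq size_le'); split=> // s' s'E.
apply: val_inj; apply: (inj_map val_inj).
by rewrite [LHS]mapK -s'E.
Qed.

(* multipartitions are ordered, hence indexed by 'I_r *)
Definition regular_multipartitions (l r n : nat) :
    {set {ffun 'I_r -> n.-bseq 'I_n.+1}} :=
  [set L : {ffun 'I_r -> n.-bseq 'I_n.+1} |
     [forall i, is_partition (parts (L i)) && regular l (parts (L i))]
     && (\sum_(i < r) sumn (parts (L i)) == n)].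

Definition B (l r : nat) (m : int) : nat :=
  match m with
  | Posz n => #|regular_multipartitions l r n|
  | Negz _ => 0
  end.

(* Main.v *)
Require Import Defs.
From mathcomp Require Import finfield zify ring.
From Stdlib Require Import Classical_Prop.
Set Implicit Arguments.
Unset Strict Implicit.
Unset Printing Implicit Defensive.
Import Order.TTheory GRing.Theory Num.Theory.
Local Open Scope ring_scope.

(* Write E(q) for the product of the 1 - q^k, k >= 1.  Modulo a prime p, the p-th power
   of a series is a series in q^p; moreover (E(q^p) / E(q))^(p a) = E(q^p)^((p-1) a),
   because E(q)^p = E(q^p).  The three congruences thus reduce to (non-)divisibility of
   the argument and to the vanishing of coefficients of E^8 (over Z) and of E^10 (modulo 3).

   E^10 = E(q) E(q^9) modulo 3, so by the pentagonal number theorem its n-th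
   coefficient vanishes unless 24n + 10 is a sum of two squares.

   For E^8, Jacobi's series for E^3 gives
     12 E^9 = sum over (i,j,k) in Z^3 of
        (-1)^(i+j+k) (i+j-2k)^3 q^(i(i-1)/2 + j(j-1)/2 + k(k-1)/2).
   On the line (k+u, k+v, k) the cubic factor is constant, and the sum over k is 0 or,
   after completing the square, a pentagonal number series, i.e. +-q^n E with
   3n + 1 = u^2 - uv + v^2.  Hence the n-th coefficient of E^8 vanishes unless
   3n + 1 is a norm from the Eisenstein integers.

   Finally a prime p = 2 (mod 3), resp. p = 3 (mod 4), cannot divide such a norm,
   resp. a sum of two squares, to an exact odd power.

   Power series are handled modulo q^N, in a commutative ring where q^N = 0. *)

(** * The pentagonal number theorem and Jacobi's identity, finite forms *)

(** If [x ^+ n = 0], all later factors are 1 and this is the full infinite product. *)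
Definition euler_prod (A : comNzRingType) (x : A) (n : nat) : A :=
  \prod_(1 <= k < n.+1) (1 - x ^+ k).

Lemma bin2_succ n : 'C(n.+1, 2) = (n + 'C(n, 2))%N.
Proof. by rewrite binS bin1 addnC. Qed.

(* Shanks' finite form of the pentagonal number theorem: modulo q^(n+1) only the
   term s = 0 survives on the left. *)
Lemma shanks_identity (A : comNzRingType) (q : A) (n : nat) :
  \sum_(0 <= s < n.+1) (-1) ^+ s * (\prod_(s.+1 <= k < n.+1) (1 - q ^+ k))
       * q ^+ (s * n + 'C(s.+1, 2))
  = 1 + \sum_(1 <= s < n.+1)
      (-1) ^+ s * (q ^+ (s * s + 'C(s, 2)) + q ^+ (s * s + 'C(s.+1, 2))).
Proof.
elim: n => [|n IH].
  by rewrite big_nat1 !big_geq // mul0n addr0 expr0 mulr1 mul1r expr0.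
rewrite big_nat_recr //= [in RHS]big_nat_recr //= addrA -IH.
rewrite (@big_geq _ _ _ n.+2 n.+2) // mulr1.
rewrite [X in _ = _ + X]mulrDr [RHS]addrA.
congr (_ + _).
(* [U s.+1 - U s] is the change of the s-th term when n grows by one, and [U 0] vanishes through its
   factor k = 0. *)
pose U s := (-1) ^+ s * (\prod_(s <= k < n.+1) (1 - q ^+ k)) * q ^+ (s * n + 'C(s.+1, 2)).
apply/eqP; rewrite -subr_eq0 opprD addrA subr_eq0 -sumrB; apply/eqP.
have -> : (-1) ^+ n.+1 * q ^+ (n.+1 * n.+1 + 'C(n.+1, 2)) = U n.+1 - U 0%N.
  rewrite /U big_geq // mulr1 big_ltn // expr0 subrr mul0r mulr0 mul0r subr0.
  by congr (_ * q ^+ _); rewrite !bin2_succ; lia.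
rewrite -telescope_sumr //; apply: eq_big_nat => s /andP[_ sn].
rewrite big_nat_recr //= /U. rewrite (@big_ltn _ _ _ s) // (exprS (-1)) mulnS.
have -> : q ^+ (s.+1 * n + 'C(s.+2, 2)) = q ^+ s * q ^+ n.+1 * q ^+ (s * n + 'C(s.+1, 2)).
  by rewrite -!exprD; congr (q ^+ _); rewrite !bin2_succ; lia.
rewrite -(addnA s) (exprD q s (s * n + _)).
ring.
Qed.

(** * Gaussian binomial coefficients and the finite Jacobi identity *)

Section QBin.
Variables (A : comNzRingType) (q : A).

(** The Gaussian binomial coefficient, given by its Pascal rule so as to avoid division in [A]. *)
Fixpoint qbin (m k : nat) : A :=
  match m, k with
  | _, 0 => 1
  | 0, _.+1 => 0
  | m'.+1, k'.+1 => qbin m' k' + q ^+ k'.+1 * qbin m' k'.+1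
  end.

Lemma qbin0 m : qbin m 0 = 1. Proof. by case: m. Qed.
Lemma qbinS m k : qbin m.+1 k.+1 = qbin m k + q ^+ k.+1 * qbin m k.+1.
Proof. by []. Qed.
Lemma qbin_small m k : (m < k)%N -> qbin m k = 0.
Proof.
elim: m k => [|m IH] [|k] //= mk; rewrite !IH ?mulr0 ?addr0 //; lia.
Qed.
Lemma qbinn m : qbin m m = 1.
Proof. by elim: m => // m IH; rewrite qbinS IH qbin_small // mulr0 addr0. Qed.

Lemma qbinS_alt m k : (k <= m)%N ->
  qbin m.+1 k.+1 = q ^+ (m - k) * qbin m k + qbin m k.+1.
Proof.
elim: m k => [|m IH] k km.
  have -> : k = 0%N by lia.
  by rewrite qbinS expr0 mul1r /= mulr0.
have [->|kn] := eqVneq k m.+1.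
  by rewrite subnn !qbinn (@qbin_small m.+1 m.+2) // expr0 mulr1 addr0.
case: k km kn => [|k] km kn.
  rewrite [LHS]qbinS [X in _ + _ * X = _](IH 0%N) // qbinS !qbin0 !subn0 expr1 exprS.
  ring.
rewrite [LHS]qbinS [X in X + _ = _](IH k) ?[X in _ + _ * X = _](IH k.+1) ?[qbin m.+1
  k.+1]qbinS ?[qbin m.+1 k.+2]qbinS; try lia.
rewrite -/(qbin m k.+1) subSS mulrDr mulrA -exprD.
have -> : (k.+2 + (m - k.+1) = m - k + k.+1)%N by lia.
rewrite exprD; ring.
Qed.

(** Combines both Pascal rules: two rows are gained, as [finite_jacobi] passes from row 2n + 1 to
    row 2n + 3. *)
Lemma qbin_step m k :
  qbin m.+2 k.+2 = (1 + q ^+ m.+1) * qbin m k.+1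
      + q ^+ (m - k) * qbin m k + q ^+ k.+2 * qbin m k.+2.
Proof.
have [km|mk] := ltnP k m.
  rewrite qbinS (qbinS_alt (ltnW km)) (@qbinS_alt m k.+1) // mulrDr mulrA -exprD.
  have -> : (k.+2 + (m - k.+1) = m.+1)%N by lia.
  ring.
rewrite (@qbin_small m k.+1) ?(@qbin_small m k.+2) ?mulr0 ?add0r ?addr0; try lia.
have [->|km] := eqVneq k m; first by rewrite !qbinn subnn mul1r.
rewrite !qbin_small ?mulr0 //; lia.
Qed.

Lemma qbin_sym k d : qbin (k + d) k = qbin (k + d) d.
Proof.
move: {2 3 4}(k + d)%N (erefl (k + d)%N) => m; elim: m k d => [|m IH] [|k] [|d] // em.
- by rewrite qbin0 -em add0n qbinn.
- by rewrite qbin0 -em addn0 qbinn.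
rewrite qbinS qbinS_alt; last by lia.
rewrite (IH k d.+1) ?(IH k.+1 d); try lia.
by rewrite addrC; congr (q ^+ _ * _ + _); lia.
Qed.

(** The quotient of q-factorials, with denominators cleared since 1 - q^k need not be invertible. *)
Lemma qbin_fact k d : qbin (k + d) k * euler_prod q k * euler_prod q d = euler_prod q (k + d).
Proof.
rewrite /euler_prod.
move: {2}(k + d)%N (erefl (k + d)%N) => m; elim: m k d => [|m IH] [|k] [|d] // em.
- by rewrite !big_geq ?mulr1.
- by rewrite qbin0 big_geq // !mul1r.
- by rewrite addn0 qbinn [X in _ * X]big_geq // mul1r mulr1.
have e1 : (k + d.+1 = m)%N by lia.
have e2 : (k.+1 + d = m)%N by lia.
rewrite addSn qbinS e1 [in RHS]big_nat_recr //=.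
have I1 := IH _ _ e1; have I2 := IH _ _ e2; rewrite e1 in I1; rewrite e2 in I2.
rewrite (@big_nat_recr _ _ _ k.+1) // (@big_nat_recr _ _ _ d.+1) //=.
rewrite (@big_nat_recr _ _ _ d.+1) //= in I1.
rewrite (@big_nat_recr _ _ _ k.+1) //= in I2.
have em1 : (m.+1 = k.+1 + d.+1)%N by lia.
move: I1 I2; set P := \prod_(1 <= i < m.+1) (1 - q ^+ i); set Pk := \big[_/_]_(1 <= i < k.+1) _.
set Pd := \big[_/_]_(1 <= i < d.+1) _; rewrite em1 exprD.
set a := q ^+ k.+1; set b := q ^+ d.+1 => I1 I2.
(* 1 - ab = (1 - a) + a (1 - b) splits the new factor along the Pascal rule. *)
transitivity ((1 - a) * P + a * (1 - b) * P); last by ring.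
by rewrite -{1}I1 -I2; ring.
Qed.
#[global] Arguments qbin : simpl never.

(** Summation by parts: the weights 2k + 1 are linear in k, so only boundary terms remain. *)
Lemma sum_second_difference (h : nat -> A) K :
  \sum_(0 <= k < K) (k%:R *+ 2 + 1) * (h k - h k.+1 *+ 2 + h k.+2)
  = (K%:R *+ 2 - 1) * (h K.+1 - h K) + h 1%N + h 0%N - h K *+ 2.
Proof.
elim: K => [|K IH]; first by rewrite big_geq //; ring.
rewrite big_nat_recr //= IH -natr1; ring.
Qed.

(* By qbin_step, passing from n to n + 1 multiplies the sum by (1 - q^(n+1))^2, up to a
   second difference that sum_second_difference evaluates to 0. *)
Lemma finite_jacobi n K : (n < K)%N ->
  \sum_(0 <= k < K) (-1) ^+ k * (k%:R *+ 2 + 1) * q ^+ 'C(k.+1, 2) * qbin n.*2.+1 (n + k).+1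
  = euler_prod q n ^+ 2.
Proof.
elim: n => [|n IH] nK.
  case: K nK => // K _; rewrite big_nat_recl //= big1 ?addr0 => [|i _].
    rewrite /euler_prod big_geq //= bin_small // qbinn; ring.
  by rewrite qbin_small ?mulr0.
have {IH} := IH (ltnW nK); set S := \sum_(_ <= _ < _) _ => SE.
rewrite /euler_prod big_nat_recr //= -/(euler_prod q n) exprMn -SE.
pose h k := (-1) ^+ k * q ^+ 'C(k, 2) * qbin n.*2.+1 (n + k).
(* The middle entries n and n + 1 of row 2n + 1 agree, and enter with opposite signs. *)
have h0 : h 1%N + h 0%N = 0.
  rewrite /h expr0 expr1 !bin_small // !expr0 addn0 addn1 !mul1r mulr1.
  have -> : (n.*2.+1 = n + n.+1)%N by lia.
  rewrite qbin_sym; ring.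
have hK k : (K <= k)%N -> h k = 0.
  by move=> Kk; rewrite /h qbin_small ?mulr0 //; lia.
have SD := sum_second_difference h K.
have : \sum_(0 <= k < K) (k%:R *+ 2 + 1) * (h k - h k.+1 *+ 2 + h k.+2) = 0.
  by rewrite SD -[_ + h 1%N + _]addrA h0 (hK K) // (hK K.+1) //; ring.
move=> D0; rewrite -[RHS]addr0 -[X in _ = _ + X](mulr0 (q ^+ n.+1)).
rewrite -[X in _ = _ + _ * X]D0 mulr_sumr /S mulr_suml.
rewrite -big_split /=. apply: eq_big_nat => k _.
have -> : (n.+1.*2.+1 = n.*2.+1.+2)%N by lia.
have -> : ((n.+1 + k).+1 = (n + k).+2)%N by lia.
rewrite qbin_step /h.
(* Beyond n + 1 the subtraction 2n + 1 - (n + k) would truncate, but there all coefficients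
   vanish. *)
have [kn|nk] := leqP k n.+1; last first.
  rewrite !qbin_small; try lia.
  ring.
have -> : q ^+ n.*2.+2 = q ^+ n.+1 * q ^+ n.+1 by rewrite -exprD; congr (q ^+ _); lia.
have -> : q ^+ (n + k).+2 = q ^+ n.+1 * q ^+ k.+1 by rewrite -exprD; congr (q ^+ _); lia.
have -> : q ^+ n.+1 = q ^+ (n.*2.+1 - (n + k)) * q ^+ k.
  by rewrite -exprD; congr (q ^+ _); lia.
have -> : q ^+ 'C(k.+2, 2) = q * q ^+ k * q ^+ k * q ^+ 'C(k, 2).
  by rewrite -exprS -!exprD; congr (q ^+ _); rewrite !bin2_succ; lia.
have -> : q ^+ 'C(k.+1, 2) = q ^+ k * q ^+ 'C(k, 2) by rewrite -exprD bin2_succ.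
rewrite !addnS !exprS; ring.
Qed.
End QBin.

(** * Theta series over Z with a nilpotent variable *)

Lemma eq_big_supp (R : eqType) (idx : R) (op : Monoid.com_law idx) (I : eqType)
    (s s' : seq I) (F : I -> R) : uniq s -> uniq s' ->
  (forall i, F i != idx -> (i \in s) = (i \in s')) ->
  \big[op/idx]_(i <- s) F i = \big[op/idx]_(i <- s') F i.
Proof.
move=> us us' Fss'.
rewrite -(@big_rmcond _ _ _ _ s (fun i => F i != idx)) => [|i /negPn/eqP//].
rewrite -[RHS](@big_rmcond _ _ _ _ s' (fun i => F i != idx)) => [|i /negPn/eqP//].
rewrite -big_filter -[RHS]big_filter; apply/perm_big/uniq_perm; rewrite ?filter_uniq // => i.
by rewrite !mem_filter; case Fi: (F i != idx) => //=; apply: Fss'.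
Qed.

Section Box.

(* The interval ]-L, L], stable under i |-> 1 - i. *)
Definition box (L : nat) : seq int :=
  [seq k.+1%:Z | k <- iota 0 L] ++ [seq - k%:Z | k <- iota 0 L].

Lemma mem_box L i : (i \in box L) = (- L%:Z < i <= L%:Z).
Proof.
rewrite mem_cat; apply/orP/idP.
  by case=> /mapP[k]; rewrite mem_iota => kL ->; lia.
move=> iL; have [i0|i0] := lerP i 0; [right|left]; apply/mapP.
  by exists `|i|%N; rewrite ?mem_iota; lia.
by exists (`|i|%N.-1); rewrite ?mem_iota; lia.
Qed.

Lemma box_uniq L : uniq (box L).
Proof.
rewrite cat_uniq !map_inj_uniq ?iota_uniq //=; try by move=> x y; lia.
rewrite andbT; apply/hasPn => _ /mapP[k kL ->]; apply/mapP => -[k' _]; lia.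
Qed.

Variable V : nmodType.
Implicit Types F : int -> V.

Lemma sum_box L F :
  \sum_(i <- box L) F i = \sum_(0 <= k < L) (F k.+1%:Z + F (- k%:Z)).
Proof. by rewrite big_cat /= !big_map big_split /index_iota subn0. Qed.

Lemma sum_box_antisym (W : zmodType) L (F : int -> W) :
  (forall i, F (1 - i) = - F i) -> \sum_(i <- box L) F i = 0.
Proof.
move=> FN; rewrite big_cat /= !big_map -big_split big1 //= => k _.
have -> : - k%:Z = 1 - k.+1%:Z by lia.
by rewrite FN subrr.
Qed.

(** A change of variable in a sum over Z: the boxes only have to be large enough to hold the
    support. *)
Lemma reindex_box (h g : int -> int) L L' F : cancel h g -> cancel g h ->
  (forall i, F i != 0 -> (i \in box L) && (g i \in box L')) ->
  \sum_(i <- box L) F i = \sum_(i <- box L') F (h i).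
Proof.
move=> hg gh Fs; rewrite -(big_map h predT F); apply: eq_big_supp.
- exact: box_uniq.
- by rewrite map_inj_uniq ?box_uniq //; apply: can_inj hg.
- by move=> i /Fs /andP[-> giL]; apply/esym/mapP; exists (g i).
Qed.
End Box.

(* Only applied to nonnegative even integers. *)
Definition half_int (i : int) : nat := `|i|%N./2.

Definition sgnz (A : comNzRingType) (i : int) : A := (-1) ^+ `|i|%N.

Lemma sgnzD (A : comNzRingType) i j : sgnz A (i + j) = sgnz A i * sgnz A j.
Proof.
rewrite /sgnz -exprD -signr_odd -[RHS]signr_odd; congr (_ ^+ nat_of_bool _); lia.
Qed.

Lemma sgnzN (A : comNzRingType) i : sgnz A (- i) = sgnz A i.
Proof. by rewrite /sgnz abszN. Qed.

Lemma sgnz_sqr (A : comNzRingType) i : sgnz A i * sgnz A i = 1.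
Proof. by rewrite -expr2 sqrr_sign. Qed.

Definition tri (i : int) : nat := half_int (i * (i - 1)).
Definition pent (i : int) : nat := half_int (i * (3 * i - 1)).

Lemma triE i : (tri i)%:Z * 2 = i * (i - 1).
Proof.
have i0 : 0 <= i * (i - 1) by nia.
have : ~~ odd (absz (i * (i - 1))) by rewrite abszM oddM; lia.
rewrite /tri /half_int; lia.
Qed.

Lemma pentE i : (pent i)%:Z * 2 = i * (3 * i - 1).
Proof.
have i0 : 0 <= i * (3 * i - 1) by nia.
have : ~~ odd (absz (i * (3 * i - 1))) by rewrite abszM oddM; lia.
rewrite /pent /half_int; lia.
Qed.

Section Nilp.
Variables (A : comNzRingType) (q : A) (N : nat).
Hypothesis qN : q ^+ N = 0.

Lemma expr_ge_nilp m : (N <= m)%N -> q ^+ m = 0.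
Proof. by move=> /subnK <-; rewrite exprD qN mulr0. Qed.

(** A factor 1 - q^k with k > m fixes q^j, as j + k >= N. *)
Lemma euler_prod_stable j m m' : (m <= m')%N -> (N <= m.+1 + j)%N ->
  q ^+ j * euler_prod q m' = q ^+ j * euler_prod q m.
Proof.
move=> mm' Nm; rewrite /euler_prod (@big_cat_nat _ _ _ m.+1) //= mulrA [RHS]mulrC.
rewrite mulrAC [RHS]mulrC; congr (_ * _).
rewrite mulrC; elim: m' mm' => [|m' IH] mm'; first by rewrite big_geq ?mul1r //; lia.
have [->|mn] := eqVneq m m'.+1; first by rewrite big_geq ?mul1r.
rewrite big_nat_recr /=; last by lia.
rewrite -mulrA [X in _ * X]mulrBl mul1r -exprD (expr_ge_nilp (m := (m'.+1 + j)%N)); last by lia.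
by rewrite subr0 IH; last by lia.
Qed.

(** Each factor is inverted by a finite geometric series in the nilpotent q^k. *)
Lemma euler_prod_unit m : exists u, euler_prod q m * u = 1.
Proof.
elim: m => [|m [u mu]]; first by exists 1; rewrite /euler_prod big_geq ?mulr1.
exists (u * \sum_(i < N) (q ^+ m.+1) ^+ i).
rewrite /euler_prod big_nat_recr //= mulrACA mu mul1r.
by apply: oppr_inj; rewrite -mulNr opprB -subrX1 -exprM mulnC exprM qN expr0n /= sub0r.
Qed.


(** With [pent_out], this makes sums over [box N] the full theta series over Z. *)
Lemma tri_out i : (i \notin box N) -> q ^+ tri i = 0.
Proof. rewrite mem_box => iN; apply: expr_ge_nilp; have := triE i; nia. Qed.

Lemma pent_out i : (i \notin box N) -> q ^+ pent i = 0.
Proof. rewrite mem_box => iN; apply: expr_ge_nilp; have := pentE i; nia. Qed.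

Lemma pentagonal : \sum_(k <- box N) sgnz A k * q ^+ pent k = euler_prod q N.
Proof.
have := shanks_identity q N;
  rewrite big_ltn // [X in _ + X = _]big_nat [X in _ + X = _]big1 ?addr0; last first.
  move=> s /andP[s0 sN]; rewrite (expr_ge_nilp (m := (s * N + 'C(s.+1, 2))%N)) ?mulr0 //; nia.
rewrite expr0 mul1r mul0n add0n bin_small // expr0 mulr1 -/(euler_prod q N) => ->.
rewrite sum_box big_split /= addrC.
(* The term k = -N, absent from [box N], is zero; adding it and splitting off k = 0 matches the
   range of [shanks_identity]. *)
have -> : \sum_(0 <= k < N) sgnz A (- k%:Z) * q ^+ pent (- k%:Z) =
  1 + \sum_(1 <= k < N.+1) sgnz A (- k%:Z) * q ^+ pent (- k%:Z).
  have -> : 1 = sgnz A (- 0%:Z) * q ^+ pent (- 0%:Z) by rewrite mul1r.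
  rewrite -(@big_ltn _ _ _ 0 N.+1 (fun k => sgnz A (- k%:Z) * q ^+ pent (- k%:Z))) //.
  by rewrite big_nat_recr //= pent_out ?mulr0 ?addr0 // mem_box; lia.
rewrite -addrA; congr (_ + _).
rewrite !big_add1 -big_split /=.
apply: eq_big_nat => s _; rewrite sgnzN -mulrDr addrC.
congr (_ * (q ^+ _ + q ^+ _)).
  have := pentE s.+1%:Z; have := bin2_succ s; have := bin2 s; nia.
have := pentE (- s.+1%:Z); have := bin2 s.+2; nia.
Qed.

(** Pairing i = k + 1 with i = -k yields minus the usual series of (-1)^k (2k + 1) q^(k(k+1)/2). *)
Lemma jacobi : \sum_(i <- box N) sgnz A i * i%:~R * q ^+ tri i = - euler_prod q N ^+ 3.
Proof.
have [u Eu] := euler_prod_unit N.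
set E := euler_prod q N in Eu *.
have EI x y : E * x = E * y -> x = y.
  by move=> /(congr1 ( *%R u)); rewrite !mulrA [u * E]mulrC Eu !mul1r.
(* E^4 is the finite identity at n = N times E^2; next to q^(k(k+1)/2), [qbin] times E^2 reduces to
   E. *)
apply: EI; have FJ := finite_jacobi q (ltnSn N); rewrite -/E in FJ.
rewrite mulrN -exprS (exprD E 2 2) -{1}FJ mulr_suml sum_box mulr_sumr -sumrN.
rewrite big_nat_recr //= (expr_ge_nilp (m := 'C(N.+1, 2))); last by have := bin2_succ N; lia.
rewrite mulr0 !mul0r oppr0 addr0; apply: eq_big_nat => k /andP[_ kN].
have [-> ->] : tri k.+1%:Z = 'C(k.+1, 2) /\ tri (- k%:Z) = 'C(k.+1, 2).
  have := triE k.+1%:Z; have := triE (- k%:Z); have := bin2 k.+1; nia.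
have -> : sgnz A k.+1%:Z = - (-1) ^+ k by rewrite /sgnz exprS mulN1r.
have -> : sgnz A (- k%:Z) = (-1) ^+ k by rewrite sgnzN.
have QE : q ^+ 'C(k.+1, 2) * qbin q N.*2.+1 (N + k).+1 * E ^+ 2 = q ^+ 'C(k.+1, 2) * E.
  have := qbin_fact q (N + k).+1 (N - k).
  have -> : ((N + k).+1 + (N - k) = N.*2.+1)%N by lia.
  move=> /(congr1 ( *%R (q ^+ 'C(k.+1, 2)))); rewrite (euler_prod_stable (m := N)); try lia.
  rewrite -/E => <-; rewrite !mulrA -[RHS]mulrA [_ * euler_prod q (N - k)]mulrC.
  (* The power of q hides the change of length of the products: k(k+1)/2 >= k covers the length N -
     k. *)
  have S1 : euler_prod q (N + k).+1 * q ^+ 'C(k.+1, 2) = E * q ^+ 'C(k.+1, 2).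
    by rewrite mulrC (euler_prod_stable (m := N)) 1?mulrC //; lia.
  have S2 : euler_prod q (N - k) * q ^+ 'C(k.+1, 2) = E * q ^+ 'C(k.+1, 2).
    rewrite mulrC -(euler_prod_stable (m' := N)) 1?mulrC //; try lia.
    by have := bin2_succ k; lia.
  move: S1 S2; set a := q ^+ _; set b := qbin _ _ _; set X := euler_prod _ _;
    set Y := euler_prod _ _.
  move=> S1 S2; transitivity (b * E * (E * a)); first by ring.
  transitivity (b * Y * (X * a)); last by ring.
  by rewrite -S2 S1; ring.
have -> : k.+1%:~R = k%:R + 1 :> A by rewrite natr1.
rewrite mulrNz -[k%:~R]/(k%:R).
transitivity (- ((-1) ^+ k * (k%:R *+ 2 + 1) * (q ^+ 'C(k.+1, 2) * E))); first by ring.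
by rewrite -QE; ring.
Qed.
End Nilp.

(** * The eighth power of the Euler product *)

Section Supported.
Variables (A : comNzRingType) (q : A).

(** Elements of a ring with nilpotent q have no coefficients; an integral expansion with exponents
    in [S] replaces them, and [coef_supported] reads it back. *)
Definition supported (S : nat -> Prop) (x : A) := exists s : seq (int * nat),
  (forall c, c \in s -> S c.2) /\ x = \sum_(c <- s) c.1%:~R * q ^+ c.2.

Lemma supported0 S : supported S 0.
Proof. by exists [::]; rewrite big_nil. Qed.

Lemma supportedX (S : nat -> Prop) n : S n -> supported S (q ^+ n).
Proof.
by exists [:: (1, n)]; split=> [c|]; rewrite ?inE ?big_seq1 ?mul1r // => /eqP->.
Qed.

Lemma supportedD S x y : supported S x -> supported S y -> supported S (x + y).
Proof.
move=> [s [Ss ->]] [r [Sr ->]]; exists (s ++ r); rewrite big_cat; split=> // c.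
by rewrite mem_cat => /orP[/Ss|/Sr].
Qed.

Lemma supportedZ S x (z : int) : supported S x -> supported S (z%:~R * x).
Proof.
move=> [s [Ss ->]]; exists [seq (z * c.1, c.2) | c <- s]; split.
  by move=> _ /mapP[c /Ss Sc ->].
by rewrite big_map mulr_sumr; apply: eq_bigr => c _; rewrite mulrA intrM.
Qed.

Lemma supported_sgnz S x (i : int) : supported S x -> supported S (sgnz A i * x).
Proof.
by move/(supportedZ (sgnz int i)); rewrite /sgnz rmorphXn /= rmorphN1.
Qed.

Lemma supported_sum S (I : Type) (r : seq I) (F : I -> A) :
  (forall i, supported S (F i)) -> supported S (\sum_(i <- r) F i).
Proof.
move=> FS; elim/big_ind: _ => //; [exact: supported0 | exact: supportedD].
Qed.
End Supported.

Lemma double_int_inj (m n : nat) : m%:Z * 2 = n%:Z * 2 -> m = n.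
Proof. lia. Qed.

Section EighthPower.
Variables (A : comNzRingType) (q : A) (N : nat).
Hypothesis qN : q ^+ N = 0.

Let f (i : int) : A := sgnz A i * q ^+ tri i.
Let T a := \sum_(i <- box N) f i * i%:~R ^+ a.
Let E := euler_prod q N.

Let f_supp i : f i != 0 -> i \in box N.
Proof. by apply: contraNT => /(tri_out qN); rewrite /f => ->; rewrite mulr0. Qed.

Let T0 : T 0 = 0.
Proof.
apply: sum_box_antisym => i; rewrite !expr0 !mulr1 /f.
have -> : tri (1 - i) = tri i by have := triE i; have := triE (1 - i); nia.
by rewrite sgnzD sgnzN /sgnz expr1 -mulrA mulN1r.
Qed.

Let T1 : T 1 = - E ^+ 3.
Proof. by rewrite -(jacobi qN); apply: eq_bigr => i _; rewrite mulrAC. Qed.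

Let moment (c0 c1 c2 c3 : A) :
  \sum_(i <- box N) f i * (c0 + c1 * i%:~R + c2 * i%:~R ^+ 2 + c3 * i%:~R ^+ 3)
  = c0 * T 0 + c1 * T 1 + c2 * T 2 + c3 * T 3.
Proof.
rewrite /T !mulr_sumr -!big_split /=; apply: eq_bigr => i _; ring.
Qed.

(* As T 0 = 0, only the monomial -12 i j k of the cube contributes. *)
Let cubic_sum :
  \sum_(k <- box N) \sum_(i <- box N) \sum_(j <- box N)
     f k * f i * f j * (i%:~R + j%:~R - k%:~R *+ 2) ^+ 3 = E ^+ 9 *+ 12.
Proof.
transitivity (\sum_(k <- box N) \sum_(i <- box N)
  f k * (f i * (T 3 + 3 * (i%:~R - k%:~R *+ 2) * T 2 + 3 * (i%:~R - k%:~R *+ 2) ^+ 2 * T 1))).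
  apply: eq_bigr => k _; apply: eq_bigr => i _.
  set w := i%:~R - k%:~R *+ 2.
  transitivity (f k * (f i * \sum_(j <- box N) f j *
    (w ^+ 3 + (3 * w ^+ 2) * j%:~R + (3 * w) * j%:~R ^+ 2 + 1 * j%:~R ^+ 3))).
    rewrite !mulr_sumr; apply: eq_bigr => j _; rewrite /w; ring.
  rewrite moment T0; ring.
transitivity (\sum_(k <- box N) f k * (6 * T 1 * T 2 - 12 * k%:~R * T 1 ^+ 2)).
  apply: eq_bigr => k _; rewrite -mulr_sumr; congr (_ * _).
  transitivity (\sum_(i <- box N) f i * (
    (T 3 - 6 * k%:~R * T 2 + 12 * k%:~R ^+ 2 * T 1) + (3 * T 2 - 12 * k%:~R * T 1) * i%:~R
    + (3 * T 1) * i%:~R ^+ 2 + 0 * i%:~R ^+ 3)); first by apply: eq_bigr => i _; ring.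
  rewrite moment T0; ring.
transitivity (\sum_(k <- box N) f k * ((6 * T 1 * T 2) + (- 12 * T 1 ^+ 2) * k%:~R
   + 0 * k%:~R ^+ 2 + 0 * k%:~R ^+ 3)); first by apply: eq_bigr => k _; ring.
rewrite moment T0 T1; ring.
Qed.

(* Write u + v = 3 a + r and shift k by a: for r = 0 the terms cancel under t |-> 1 - t,
   otherwise the exponent becomes a pentagonal number plus a constant. *)
Let orbit_sum u v : \sum_(k <- box N) f k * f (u + k) * f (v + k) = 0 \/
  exists (n : nat) (b : int), 3 * n%:Z + 1 = u ^+ 2 - u * v + v ^+ 2 /\
    \sum_(k <- box N) f k * f (u + k) * f (v + k) = sgnz A b * q ^+ n * E.
Proof.
have F_supp k : f k * f (u + k) * f (v + k) != 0 -> k \in box N.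
  by move=> F0; apply: f_supp; apply: contraNneq F0 => ->; rewrite !mul0r.
have sgE k : sgnz A k * sgnz A (u + k) * sgnz A (v + k) = sgnz A (u + v) * sgnz A k.
  by rewrite !sgnzD -[in RHS](mul1r (sgnz A k)) -(sgnz_sqr A k); ring.
have ER L : (N <= L)%N -> \sum_(t <- box L) sgnz A t * q ^+ pent t = E.
  move=> NL; rewrite /E -(pentagonal qN); apply: eq_big_supp; rewrite ?box_uniq // => i.
  move=> pi0; have iN : i \in box N.
    by apply: contraNT pi0 => /(pent_out qN)->; rewrite mulr0.
  by rewrite iN; move: iN; rewrite !mem_box; lia.
have [a ha] : exists a, [\/ v = 3 * a - u, v = 3 * a + 1 - u | v = 3 * a + 2 - u].
  exists ((u + v) %/ 3)%Z; have := divz_eq (u + v) 3.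
  have := modz_ge0 (u + v) (isT : 3 != 0 :> int).
  have := ltz_pmod (u + v) (isT : 0 < 3 :> int).
  set r := modz _ _ => r3 r0 uvE.
  have [r_eq|[r_eq|r_eq]] : r = 0 \/ r = 1 \/ r = 2 by lia.
  - apply: Or31; lia.
  - apply: Or32; lia.
  - apply: Or33; lia.
(* Room for the image of [box N] under translation by a and, with the extra 1, under t |-> -t -
   a. *)
pose L := (N + `|a|.+1)%N.
have RI (h g : int -> int) : cancel h g -> cancel g h -> 
  (forall i, i \in box N -> g i \in box L) ->
  \sum_(k <- box N) f k * f (u + k) * f (v + k)
  = \sum_(t <- box L) f (h t) * f (u + h t) * f (v + h t).
  move=> hg gh gL; apply: (reindex_box hg gh) => i /F_supp iN; by rewrite iN gL.
have fff k : f k * f (u + k) * f (v + k) =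
  sgnz A (u + v) * sgnz A k * q ^+ (tri k + tri (u + k) + tri (v + k)).
  by rewrite -sgE /f !exprD; ring.
case: ha => hv.
- left; rewrite (RI (fun t => t - a) (fun t => t + a)); first last.
  + by move=> i; rewrite !mem_box /L; lia.
  + by move=> i; rewrite addrK.
  + by move=> i; rewrite subrK.
  apply: sum_box_antisym => t; rewrite !fff.
  have -> : (tri (1 - t - a) + tri (u + (1 - t - a)) + tri (v + (1 - t - a)) =
    tri (t - a) + tri (u + (t - a)) + tri (v + (t - a)))%N.
    apply: double_int_inj; rewrite !PoszD !mulrDl !triE hv; ring.
  have -> : sgnz A (1 - t - a) = - sgnz A (t - a).
    by rewrite -addrA sgnzD -opprD sgnzN (sgnzD A t a) (sgnzD A t) sgnzN /sgnz expr1 mulN1r.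
  ring.
- right; pose n := u ^+ 2 - u * (3 * a + 1) + 3 * a ^+ 2 + 2 * a.
  have n3 : 3 * n + 1 = u ^+ 2 - u * v + v ^+ 2 by rewrite hv /n; ring.
  have n0 : 0 <= n by nia.
  have nE : `|n|%N%:Z = n by lia.
  exists `|n|%N, (u + v + a); split; first by rewrite nE.
  rewrite (RI (fun t => t - a) (fun t => t + a)); first last.
  + by move=> i; rewrite !mem_box /L; lia.
  + by move=> i; rewrite addrK.
  + by move=> i; rewrite subrK.
  rewrite -(ER L) ?leq_addr // mulr_sumr; apply: eq_bigr => t _; rewrite fff.
  have -> : (tri (t - a) + tri (u + (t - a)) + tri (v + (t - a)) = `|n| + pent t)%N.
    apply: double_int_inj; rewrite !PoszD !mulrDl !triE pentE nE hv /n; ring.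
  rewrite exprD (sgnzD A t) sgnzN (sgnzD A (u + v)); ring.
- right; pose n := u ^+ 2 - u * (3 * a + 2) + 3 * a ^+ 2 + 4 * a + 1.
  have n3 : 3 * n + 1 = u ^+ 2 - u * v + v ^+ 2 by rewrite hv /n; ring.
  have n0 : 0 <= n by nia.
  have nE : `|n|%N%:Z = n by lia.
  exists `|n|%N, (u + v + a); split; first by rewrite nE.
  (* Here the linear term has the opposite sign, so t is reflected as well as shifted. *)
  rewrite (RI (fun t => - t - a) (fun t => - t - a)); first last.
  + by move=> i; rewrite !mem_box /L; lia.
  + by move=> i; lia.
  + by move=> i; lia.
  rewrite -(ER L) ?leq_addr // mulr_sumr; apply: eq_bigr => t _; rewrite fff.
  have -> : (tri (- t - a) + tri (u + (- t - a)) + tri (v + (- t - a)) = `|n| + pent t)%N.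
    apply: double_int_inj; rewrite !PoszD !mulrDl !triE pentE nE hv /n; ring.
  rewrite exprD (sgnzD A (- t)) !sgnzN (sgnzD A (u + v)); ring.
Qed.

(** Group [cubic_sum] by u = i - k and v = j - k: every orbit is 0 or a signed q^n times E, with
    weight (u + v)^3, and the unit E is then divided out. The factor 12 stays since [A] may have
    torsion. *)
Lemma euler_prod8_supported :
  supported q (fun n => exists u v : int, 3 * n%:Z + 1 = u ^+ 2 - u * v + v ^+ 2) (E ^+ 8
    *+ 12).
Proof.
have [w Ew] := euler_prod_unit qN N.
have -> : E ^+ 8 *+ 12 = E ^+ 9 *+ 12 * w.
  by rewrite (exprSr E 8) -mulrnAl -mulrA Ew mulr1.
pose c (u v : int) : A := ((u + v) ^+ 3)%:~R.
rewrite -cubic_sum (_ : \sum_(k <- box N) _ = \sum_(u <- box N.*2) \sum_(v <- box N.*2)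
   c u v * \sum_(k <- box N) f k * f (u + k) * f (v + k)); last first.
  transitivity (\sum_(k <- box N) \sum_(u <- box N.*2) \sum_(v <- box N.*2)
       c u v * (f k * f (u + k) * f (v + k))).
    rewrite big_seq [RHS]big_seq; apply: eq_bigr => k kN.
    rewrite (@reindex_box _ (fun i => i + k) (fun i => i - k) _ N.*2); first last.
    - move=> i i0; have iN : i \in box N.
        apply: f_supp; apply: contraNneq i0 => fi.
        by rewrite big1 // => j _; rewrite fi mulr0 !mul0r.
      by rewrite iN; move: iN kN; rewrite !mem_box; lia.
    - by move=> i; lia.
    - by move=> i; lia.
    apply: eq_bigr => u _.
    rewrite (@reindex_box _ (fun i => i + k) (fun i => i - k) _ N.*2); first last.
    - move=> i i0; have iN : i \in box N.
        by apply: f_supp; apply: contraNneq i0 => ->; rewrite mulr0 !mul0r.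
      by rewrite iN; move: iN kN; rewrite !mem_box; lia.
    - by move=> i; lia.
    - by move=> i; lia.
    apply: eq_bigr => v _; rewrite /c rmorphXn /= !rmorphD /=; ring.
  rewrite exchange_big; apply: eq_bigr => u _.
  rewrite exchange_big; apply: eq_bigr => v _.
  by rewrite mulr_sumr.
rewrite mulr_suml; apply: supported_sum => u; rewrite mulr_suml; apply: supported_sum => v.
rewrite -mulrA; apply: supportedZ.
have [->|[n [b [Sn ->]]]] := orbit_sum u v; first by rewrite mul0r; apply: supported0.
rewrite -[X in supported _ _ X]mulrA Ew mulr1.
by apply/supported_sgnz/supportedX; exists u, v.
Qed.
End EighthPower.

(** * Coefficients of the generating series *)

Section Truncation.
Variables (R : comNzRingType) (N : nat).
Local Notation trunc := (in_qpoly ('X^N : {poly R})).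

Lemma coef_trunc (p : {poly R}) i : (i < N)%N -> (trunc p : {poly R})`_i = p`_i.
Proof.
move=> iN; rewrite /= mk_monic_Xn prednK ?(leq_trans _ iN) //.
by rewrite -Pdiv.RingMonic.take_poly_rmodp coef_take_poly iN.
Qed.

Lemma truncX_nilp : (0 < N)%N -> trunc 'X ^+ N = 0.
Proof.
move=> N0; rewrite -rmorphXn; apply: val_inj => /=.
by rewrite mk_monic_Xn prednK // Pdiv.RingMonic.rmodpp ?monicXn.
Qed.

Lemma coef_supported S (p : {poly R}) n :
  supported (trunc 'X) S (trunc p) -> (n < N)%N -> ~ S n -> p`_n = 0.
Proof.
move=> [s [Ss Ep]] nN Sn; rewrite -coef_trunc // Ep.
have -> : \sum_(c <- s) c.1%:~R * trunc 'X ^+ c.2 = trunc (\sum_(c <- s) c.1%:~R * 'X^(c.2)).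
  by rewrite rmorph_sum; apply: eq_bigr => c _; rewrite rmorphM rmorph_int rmorphXn.
rewrite coef_trunc // coef_sum big_seq big1 // => c /Ss Sc.
rewrite mulrzl coefMrz coefXn; case: eqP => [nc|_]; last by rewrite mul0rz.
by case: Sn; rewrite nc.
Qed.
End Truncation.

(** The form is the norm of u + v w, with w a primitive cube root of unity. *)
Definition eisenstein_norm (n : nat) : Prop :=
  exists u v : int, 3 * n%:Z + 1 = u ^+ 2 - u * v + v ^+ 2.

Lemma euler_prod_morph (A A' : comNzRingType) (f : {rmorphism A -> A'}) x n :
  f (euler_prod x n) = euler_prod (f x) n.
Proof. by rewrite rmorph_prod; apply: eq_bigr => k _; rewrite rmorphB rmorph1 rmorphXn. Qed.

Lemma coef_euler_prod8 N n : (n < N)%N -> ~ eisenstein_norm n ->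
  ((euler_prod 'X N : {poly int}) ^+ 8)`_n = 0.
Proof.
move=> nN Sn; have := euler_prod8_supported (truncX_nilp int (leq_ltn_trans (leq0n n) nN)).
rewrite -euler_prod_morph -rmorphXn -rmorphMn => /coef_supported/(_ nN Sn)/eqP.
by rewrite coefMn mulrn_eq0 => /eqP.
Qed.

(** In characteristic 3 the factor 12 is zero, so it is cancelled over Z first, and the result is
    specialised along X |-> q. *)
Lemma euler_prod8_eisenstein (A : comNzRingType) (q : A) N : q ^+ N = 0 ->
  supported q eisenstein_norm (euler_prod q N ^+ 8).
Proof.
move=> qN; set G : {poly int} := euler_prod 'X N ^+ 8.
have -> : euler_prod q N ^+ 8 = (map_poly intr G).[q].
  by rewrite -[RHS]/(horner_eval q _) /G !rmorphXn /= !euler_prod_morph /= map_polyX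
    /horner_eval hornerX.
rewrite /map_poly horner_poly.
apply: supported_sum => i /=.
have [Gi|/eqP Gi] := eqVneq G`_i 0.
  by rewrite Gi mul0r; apply: supported0.
have [iN|Ni] := ltnP i N; last by rewrite (expr_ge_nilp qN Ni) mulr0; apply: supported0.
apply/supportedZ/supportedX; apply: NNPP => Sn; apply: Gi; exact: coef_euler_prod8.
Qed.

Lemma supported_exp (A : comNzRingType) (q : A) m S x :
  supported (q ^+ m) S x -> supported q (fun n => exists2 k, S k & n = (m * k)%N) x.
Proof.
move=> [s [Ss ->]]; exists [seq (c.1, (m * c.2)%N) | c <- s]; split.
  by move=> _ /mapP[c /Ss Sc ->]; exists c.2.
by rewrite big_map; apply: eq_bigr => c _; rewrite exprM.
Qed.

(** * Frobenius and powers of the Euler product *)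

Lemma euler_prod_pchar (A : comNzRingType) (p : nat) (x : A) n :
  p \in [pchar A] -> euler_prod x n ^+ p = euler_prod (x ^+ p) n.
Proof.
move=> pA; rewrite -(pFrobenius_autE pA) rmorph_prod; apply: eq_bigr => k _.
by rewrite rmorphB rmorph1 /= pFrobenius_autE -!exprM mulnC.
Qed.

Lemma euler_prod10_two_squares (A : comNzRingType) (q : A) N : q ^+ N = 0 ->
  3 \in [pchar A] ->
  supported q (fun n => exists x y : int, 24 * n%:Z + 10 = x ^+ 2 + y ^+ 2)
    (euler_prod q N ^+ 10).
Proof.
move=> qN A3; have q9N : (q ^+ 9) ^+ N = 0 by rewrite exprAC qN expr0n.
rewrite exprS (exprM _ 3 3) !(euler_prod_pchar _ _ A3) -exprM.
rewrite -(pentagonal qN) -(pentagonal q9N) mulr_suml.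
apply: supported_sum => k; rewrite mulr_sumr; apply: supported_sum => l.
rewrite -mulrA; apply: supported_sgnz; rewrite mulrCA; apply: supported_sgnz.
rewrite -exprM -exprD; apply: supportedX.
(* 24 [pent k] + 1 = (6k - 1)^2, and 10 = 1 + 9. *)
exists (6 * k - 1), (3 * (6 * l - 1)).
by have := pentE k; have := pentE l; nia.
Qed.

Lemma coef_exp_pchar (R : comNzRingType) (p : nat) (f : {poly R}) n :
  p \in [pchar R] -> ~~ (p %| n)%N -> (f ^+ p)`_n = 0.
Proof.
move=> pR pn; have pP : p \in [pchar {poly R}] by rewrite pchar_poly.
rewrite -[f]coefK poly_def -(pFrobenius_autE pP) rmorph_sum coef_sum big1 //= => i _.
rewrite /= pFrobenius_autE exprZn -exprM coefZ coefXn.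
by case: eqP pn => [->|]; rewrite ?dvdn_mull ?mulr0.
Qed.

(** * Generating series of regular partitions *)

Section PartitionSeries.
Variable l : nat.

Definition regular_part (k : nat) : bool := (0 < k)%N && ~~ (l %| k)%N.

Lemma regular_partitionE s :
  is_partition s && regular l s = sorted geq s && all regular_part s.
Proof.
rewrite /is_partition /regular -andbA; congr (_ && _).
rewrite -[_ \notin _]negbK negbK -has_pred1 -all_predC -all_predI; apply: eq_all => k /=.
by rewrite /regular_part eq_sym lt0n eq_sym.
Qed.

(** Bounding multiplicities by n keeps the list finite; members of size above n may occur and are
    harmless once q^(n+1) = 0. *)
Fixpoint bounded_partitions (n k : nat) : seq (seq nat) :=
  if k is k'.+1 then
    if regular_part k then
      [seq nseq j k ++ s | j <- iota 0 n.+1, s <- bounded_partitions n k']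
    else bounded_partitions n k'
  else [:: [::]].

Lemma bounded_partitionsS n k : bounded_partitions n k.+1 =
  if regular_part k.+1 then
    [seq nseq j k.+1 ++ s | j <- iota 0 n.+1, s <- bounded_partitions n k]
  else bounded_partitions n k.
Proof. by []. Qed.
#[local] Arguments bounded_partitions : simpl never.

Lemma bounded_partitionsP n k s : s \in bounded_partitions n k ->
  sorted geq s && all (fun x => regular_part x && (x <= k)%N) s.
Proof.
elim: k s => [|k IH] s; first by rewrite inE => /eqP->.
have W s' : all (fun x => regular_part x && (x <= k)%N) s' ->
    all (fun x => regular_part x && (x <= k.+1)%N) s'.
  by apply: sub_all => x /andP[-> /leqW].
rewrite bounded_partitionsS; case: ifP => gk; last by move=> /IH /andP[-> /W].
move=> /allpairsPdep[j [s' [_ /IH/andP[ss' as'] ->]]].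
rewrite all_cat (W s' as') all_nseq gk leqnn orbT !andbT.
elim: j => //= j IHj; rewrite path_sortedE; last by move=> x y z; rewrite /geq /=; lia.
rewrite IHj andbT all_cat all_nseq /geq /= leqnn orbT.
by apply: sub_all as' => x /andP[_ /leqW].
Qed.

Lemma bounded_partitions_uniq n k : uniq (bounded_partitions n k).
Proof.
elim: k => // k IH; rewrite bounded_partitionsS; case: ifP => // _; apply: allpairs_uniq;
  rewrite ?iota_uniq //.
have C j s : s \in bounded_partitions n k -> count_mem k.+1 (nseq j k.+1 ++ s) = j.
  move=> /bounded_partitionsP/andP[_ /allP ks]; rewrite count_cat count_nseq /= eqxx mul1n.
  rewrite (count_memPn _) ?addn0 //; apply/negP => /ks; rewrite ltnn andbF //.
move=> [j s] [j' s'] /allpairsPdep[a [b [_ bk [-> ->]]]] /allpairsPdep[a' [b' [_ bk' [->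
  ->]]]] /= e.
have aa : a = a' by rewrite -(C a b bk) -(C a' b' bk') e.
move: e; rewrite aa => /(congr1 (drop a')).
by rewrite !drop_size_cat ?size_nseq // => ->.
Qed.

Lemma mem_bounded_partitions n k s : sorted geq s -> all regular_part s ->
  all (fun x => (x <= k)%N) s -> (sumn s <= n)%N -> s \in bounded_partitions n k.
Proof.
elim: k s => [|k IH] s ss gs ks sn.
  case: s ss gs ks sn => // x s _ /=; rewrite /regular_part; lia.
have D s0 : sorted geq s0 -> all (fun x => (x <= k.+1)%N) s0 ->
  exists j s', [/\ s0 = nseq j k.+1 ++ s' & all (fun x => (x <= k)%N) s'].
  elim: s0 => [|x s0 IHs] /=; first by exists 0%N, [::].
  rewrite path_sortedE; last by move=> a b c; rewrite /geq /=; lia.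
  move=> /andP[xs ss0] /andP[xk ks0].
  have [->|xk1] := eqVneq x k.+1.
    by have [j [s' [-> ks']]] := IHs ss0 ks0; exists j.+1, s'.
  exists 0%N, (x :: s0); split=> //=; apply/andP; split; first by lia.
  by apply: sub_all xs => y; rewrite /geq /=; lia.
have [j [s' [sE ks']]] := D s ss ks; move: ss gs sn;
  rewrite sE sumn_cat sumn_nseq all_cat => ss /andP[gj gs'] sn.
have s'k : s' \in bounded_partitions n k.
  apply: IH => //; last by lia.
  by apply: subseq_sorted ss; [move=> a b c; rewrite /geq /=; lia|exact: suffix_subseq].
have jn : (j <= n)%N by nia.
rewrite bounded_partitionsS; case: ifP => gk.
  by apply/allpairsPdep; exists j, s'; rewrite mem_iota ltnS jn.
by case: j gj {sE jn ss sn} => //= j; rewrite gk.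
Qed.

Variables (A : comNzRingType) (q : A) (n : nat).
Hypothesis qN : q ^+ n.+1 = 0.

(** Euler's product argument: the geometric series in q^k, cut after the exponent n, is an exact
    inverse of 1 - q^k. *)
Lemma sum_bounded_partitions k :
  (\sum_(s <- bounded_partitions n k) q ^+ sumn s)
   * \prod_(1 <= i < k.+1 | ~~ (l %| i)%N) (1 - q ^+ i) = 1.
Proof.
elim: k => [|k IH]; first by rewrite big_seq1 big_geq ?mulr1.
rewrite [X in _ * X = _]big_mkcond big_nat_recr //= -[X in _ * (X * _) = _]big_mkcond
  bounded_partitionsS /regular_part ltn0Sn andTb.
case: ifP => lk; last by rewrite mulr1.
rewrite big_allpairs_dep /= -[RHS]IH.
have -> : \sum_(j <- iota 0 n.+1) \sum_(s <- bounded_partitions n k) q ^+ sumn (nseq j k.+1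
  ++ s)
   = (\sum_(i < n.+1) (q ^+ k.+1) ^+ i) * \sum_(s <- bounded_partitions n k) q ^+ sumn s.
  rewrite mulr_suml -[iota _ _]/(index_iota 0 n.+1) big_mkord; apply: eq_bigr => j _.
  rewrite mulr_sumr; apply: eq_bigr => s _.
  by rewrite sumn_cat sumn_nseq exprD exprM.
have G : (1 - q ^+ k.+1) * \sum_(i < n.+1) (q ^+ k.+1) ^+ i = 1.
  apply: oppr_inj; rewrite -mulNr opprB -subrX1 -exprM mulnC exprM qN.
  by rewrite expr0n sub0r.
rewrite -[RHS]mul1r -[X in _ = X * _]G; ring.
Qed.

Definition regular_series : A :=
  \sum_(s : n.-bseq 'I_n.+1 | is_partition (parts s) && regular l (parts s)) q ^+ sumn
    (parts s).

Lemma regular_seriesE : regular_series = \sum_(s <- bounded_partitions n n) q ^+ sumn s.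
Proof.
rewrite /regular_series -big_filter -(big_map (fun x : n.-bseq 'I_n.+1 => parts x) predT
  (fun s => q ^+ sumn s)).
apply: eq_big_supp => [||s]; first last.
- move=> qs; have sn : (sumn s <= n)%N.
    by rewrite leqNgt; apply: contraNN qs => /(expr_ge_nilp qN) ->.
  apply/mapP/idP => [[x]|sb].
    rewrite mem_filter regular_partitionE => /andP[/andP[ss gs] _] sx; move: sn;
      rewrite sx => sn.
    by apply: mem_bounded_partitions => //; apply/allP => _ /mapP[i _ ->]; exact: leq_ord.
  have /andP[ss as_] := bounded_partitionsP sb.
  have gs : all regular_part s by apply: sub_all as_ => x /andP[].
  have sP : is_partition s && regular l s by rewrite regular_partitionE ss.
  have [x [xs _]] := partition_fits (proj1 (andP sP)) sn.
  by exists x; rewrite ?mem_filter ?xs ?sP ?mem_index_enum.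
- exact: bounded_partitions_uniq.
- rewrite map_inj_uniq ?filter_uniq ?index_enum_uniq // => x y.
  by move/(inj_map val_inj)/val_inj.
Qed.

(** The factors of E(q) of index not divisible by l cancel the series; the others form E(q^l). *)
Lemma regular_series_euler_prod : (0 < l)%N ->
  regular_series * euler_prod q n.+1 = euler_prod (q ^+ l) n.+1.
Proof.
(* The last factor is 1, so the product may stop at n, the largest part allowed. *)
move=> l0; have [nn1 qn1] : (n <= n.+1)%N /\ (n.+1 <= n.+1 + 0)%N by lia.
have := euler_prod_stable qN nn1 qn1; rewrite expr0 !mul1r => ->.
rewrite {1}/euler_prod (bigID (fun i => (l %| i)%N)) /= mulrCA.
rewrite regular_seriesE sum_bounded_partitions mulr1 -big_filter.
transitivity (\prod_(i <- [seq (l * k)%N | k <- index_iota 1 n.+2]) (1 - q ^+ i)); last first.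
  by rewrite big_map; apply: eq_bigr => k _; rewrite exprM.
apply: eq_big_supp => [||i qi].
- by rewrite filter_uniq ?iota_uniq.
- by rewrite map_inj_uniq ?iota_uniq // => x y; nia.
have iN : (i <= n)%N.
  by rewrite leqNgt; apply: contraNN qi => /(expr_ge_nilp qN) ->; rewrite subr0.
rewrite mem_filter mem_index_iota; apply/andP/mapP => [[/dvdnP[k ik] i1]|[k]].
  by exists k; rewrite ?mem_index_iota; nia.
by rewrite mem_index_iota => k1 ik; rewrite ik dvdn_mulr //; split=> //; nia.
Qed.

End PartitionSeries.

Lemma regular_series_pchar (A : comNzRingType) (q : A) (p a n : nat) :
  p \in [pchar A] -> q ^+ n.+1 = 0 ->
  regular_series p q n ^+ (p * a) = euler_prod (q ^+ p) n.+1 ^+ (p.-1 * a).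
Proof.
move=> pA qN; have p0 := prime_gt0 (pcharf_prime pA).
have qpN : (q ^+ p) ^+ n.+1 = 0 by rewrite exprAC qN expr0n eqn0Ngt p0.
have [u Eu] := euler_prod_unit qpN n.+1.
set P := regular_series p q n; set X := euler_prod (q ^+ p) n.+1 in Eu *.
(* Both sides are compared after multiplication by the unit X^a, which is E(q)^(p a). *)
have PX : P ^+ (p * a) * X ^+ a = X ^+ (p.-1 * a) * X ^+ a.
  rewrite -exprD -mulSnr prednK // /X -{1}(euler_prod_pchar _ _ pA) -exprM -exprMn.
  by rewrite regular_series_euler_prod.
have Ea : X ^+ a * u ^+ a = 1 by rewrite -exprMn Eu expr1n.
by rewrite -[LHS]mulr1 -[RHS]mulr1 -Ea !mulrA PX.
Qed.

Lemma regular_series_morph (A A' : comNzRingType) (f : {rmorphism A -> A'}) l q n :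
  f (regular_series l q n) = regular_series l (f q) n.
Proof. by rewrite rmorph_sum; apply: eq_bigr => s _; rewrite rmorphXn. Qed.

(** Distributing the r-th power gives one monomial for each ordered family of r regular
    partitions. *)
Lemma B_coef (R : comNzRingType) (l r n : nat) :
  (B l r n)%:R = (regular_series l ('X : {poly R}) n ^+ r)`_n.
Proof.
rewrite -[r in RHS]card_ord -prodr_const bigA_distr_big /= coef_sum.
transitivity (\sum_(L in ffun_on [pred s : n.-bseq 'I_n.+1 | is_partition (parts s) &&
  regular l (parts s)] |
    \sum_(i < r) sumn (parts (L i)) == n) (1 : R)).
  rewrite sumr_const; congr (_%:R); apply: eq_card => L; rewrite !inE.
  by congr (_ && _); apply/forallP/ffun_onP => LP i; have := LP i.
rewrite big_mkcondr /=; apply: eq_bigr => L _.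
by rewrite -expr_sum coefXn eq_sym; case: eqP.
Qed.

Lemma dvdn_Fp (p m : nat) : prime p -> (m%:R = 0 :> 'F_p) -> (p %| m)%N.
Proof. by move=> pP /eqP m0; rewrite (dvdn_pcharf (pchar_Fp pP)). Qed.

Lemma B_dvd_pow p l a n : prime p -> ~~ (p %| n)%N -> (p %| B l (p * a) n)%N.
Proof.
move=> pP pn; apply: dvdn_Fp => //; rewrite B_coef mulnC exprM.
exact: coef_exp_pchar (pchar_Fp pP) pn.
Qed.

(** The hypothesis ranges over all rings because it is applied at x = q^p in truncated polynomials
    over F_p; exponents then get multiplied by p. *)
Lemma B_dvd_supported p a S n : prime p ->
  (forall (A : comNzRingType) (x : A) N, p \in [pchar A] -> x ^+ N = 0 ->
     supported x S (euler_prod x N ^+ (p.-1 * a))) ->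
  ~ (exists2 k, S k & n = (p * k)%N) -> (p %| B p (p * a) n)%N.
Proof.
move=> pP HS Sn; apply: dvdn_Fp => //; rewrite B_coef.
apply: (@coef_supported _ n.+1 _ _ n _ _ Sn) => //.
have pA : p \in [pchar {poly %/ ('X^(n.+1) : {poly 'F_p})}] by rewrite pchar_qpoly pchar_Fp.
have qN := truncX_nilp 'F_p (ltn0Sn n).
rewrite rmorphXn regular_series_morph (regular_series_pchar _ pA qN).
by apply/supported_exp/HS; rewrite // exprAC qN expr0n eqn0Ngt prime_gt0.
Qed.

(** * Exact odd powers of inert primes *)

Lemma dvdz_Fp (p : nat) (u : int) : prime p -> (p %| u)%Z = (u%:~R == 0 :> 'F_p).
Proof.
move=> pP; rewrite dvdzE /= (dvdn_pcharf (pchar_Fp pP)).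
by case: u => k //=; rewrite NegzE mulrNz oppr_eq0.
Qed.

Lemma fermat_Fp (p : nat) (x : 'F_p) : prime p -> x ^+ p = x.
Proof. by move=> pP; have := expf_card x; rewrite card_Fp. Qed.

(** If p does not divide v, then r = u / v satisfies r^2 - r + 1 = 0, hence r^3 = -1. With p = 3k +
    2, Fermat gives r = (-1)^k, and the quadratic equation forces r = 2 and 3 = 0 in F_p. *)
Lemma dvd_eisenstein_form (p : nat) (u v : int) : prime p -> (p = 2 %[mod 3])%N ->
  (p %| u ^+ 2 - u * v + v ^+ 2)%Z -> (p %| u)%Z && (p %| v)%Z.
Proof.
move=> pP p2; rewrite !dvdz_Fp // rmorphD rmorphB /= !rmorphXn rmorphM /=.
set a := u%:~R; set b := v%:~R; have [->|b0] := eqVneq b 0.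
  by rewrite mulr0 subr0 expr0n addr0 expf_eq0 /= => ->.
move=> /eqP ab0; exfalso; pose r := a / b.
have r2 : r ^+ 2 = r - 1.
  have ar : a = r * b by rewrite divfK.
  have : (r ^+ 2 - r + 1) * b ^+ 2 = 0 by rewrite -ab0 ar; ring.
  move/eqP; rewrite mulf_eq0 sqrf_eq0 (negPf b0) orbF => /eqP r0.
  by apply/eqP; rewrite -subr_eq0; apply/eqP; rewrite -r0; ring.
have r3 : r ^+ 3 = -1 by rewrite exprS r2 mulrBr mulr1 -expr2 r2; ring.
have r0 : r != 0 by apply: contra_eq_neq r2 => ->;
  rewrite expr0n sub0r eq_sym oppr_eq0 oner_eq0.
pose k := (p %/ 3)%N; have pk : p = (3 * k + 2)%N by rewrite /k; lia.
pose s : 'F_p := (-1) ^+ k.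
have rs : s * r = 1.
  have rp : r ^+ (3 * k + 2) = r by rewrite -pk; apply: fermat_Fp.
  by apply: (mulIf r0); rewrite mul1r -[RHS]rp exprD exprM r3 -/s expr2 mulrA.
have s2 : s * s = 1 by rewrite -expr2 sqrr_sign.
have rE : r = s by rewrite -[LHS]mul1r -s2 -mulrA rs mulr1.
have s3 : s = 2%:R by rewrite rE expr2 s2 in r2; rewrite -[s](subrK 1) -r2.
have : (p %| 3)%N.
  apply: dvdn_Fp => //; rewrite s3 in s2.
  have -> : 3%:R = 2%:R * 2%:R - 1 :> 'F_p by ring.
  by rewrite s2 subrr.
rewrite dvdn_prime2 // => /eqP p3; by rewrite p3 in p2.
Qed.

(** If p does not divide v, then r = u / v satisfies r^2 = -1; since (p - 1) / 2 is odd, Fermat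
    gives r = -r, impossible for odd p. *)
Lemma dvd_sum_squares (p : nat) (u v : int) : prime p -> (p = 3 %[mod 4])%N ->
  (p %| u ^+ 2 + v ^+ 2)%Z -> (p %| u)%Z && (p %| v)%Z.
Proof.
move=> pP p3; rewrite !dvdz_Fp // rmorphD /= !rmorphXn /=.
set a := u%:~R; set b := v%:~R; have [->|b0] := eqVneq b 0.
  by rewrite expr0n addr0 expf_eq0 /= => ->.
move=> /eqP ab0; exfalso; pose r := a / b.
have r2 : r ^+ 2 = -1.
  have ar : a = r * b by rewrite divfK.
  have : (r ^+ 2 + 1) * b ^+ 2 = 0 by rewrite -ab0 ar; ring.
  by move/eqP; rewrite mulf_eq0 sqrf_eq0 (negPf b0) orbF addr_eq0 => /eqP.
have r0 : r != 0.
  by apply: contra_eq_neq r2 => ->; rewrite expr0n eq_sym oppr_eq0 oner_eq0.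
pose k := (p %/ 4)%N; have pk : p = (2 * (k.*2.+1) + 1)%N by rewrite /k; lia.
have : r ^+ (2 * (k.*2.+1) + 1) = r by rewrite -pk; apply: fermat_Fp.
rewrite exprD exprM r2 expr1 -signr_odd /= odd_double expr1 mulN1r => rN.
have : r *+ 2 = 0 by rewrite mulr2n -{1}rN addNr.
rewrite -mulr_natl => /eqP; rewrite mulf_eq0 (negPf r0) orbF => /eqP/(dvdn_Fp pP).
rewrite dvdn_prime2 // => /eqP p2; by rewrite p2 in p3.
Qed.

(** Descent on t: p divides u and v, so p^2 cancels from both sides; at t = 0 one is left with p
    dividing c. *)
Lemma exact_odd_power_not_represented (p t : nat) (f : int -> int -> int) (c : int) : prime p ->
  (forall u v, (p %| f u v)%Z -> (p %| u)%Z && (p %| v)%Z) ->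
  (forall a u v, f (u * a) (v * a) = a ^+ 2 * f u v) ->
  ~~ (p %| c)%Z -> forall u v, f u v <> p%:Z ^+ (2 * t + 1) * c.
Proof.
move=> pP fp f2 pc; have p0 : p%:Z != 0 by have := prime_gt0 pP; lia.
elim: t => [|t IH] u v fE; (have /fp/andP[/dvdzP[u' uE] /dvdzP[v' vE]] : (p %| f u v)%Z).
- by rewrite fE expr1 dvdz_mulr.
- apply/negP: pc; rewrite negbK; apply/dvdzP; exists (f u' v').
  by apply: (mulfI p0); move: fE; rewrite uE vE f2 expr1 => <-; ring.
- by rewrite fE addn1 exprS -mulrA dvdz_mulr.
apply: (IH u' v'); apply: (mulfI (expf_neq0 2 p0)).
rewrite -f2 -uE -vE fE mulrA -exprD; congr (_ ^+ _ * _); lia.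
Qed.

(** Serves to show that p^(2t+2) is 1 modulo 3 or 4, whence the quotients in the theorem are
    exact. *)
Lemma even_power_mod (x d : int) k : (exists z, x ^+ 2 = d * z + 1) ->
  exists z, x ^+ (2 * k + 2) = d * z + 1.
Proof.
move=> [z xz]; elim: k => [|k [y xy]]; first by exists z.
exists (y + z + d * y * z); have -> : (2 * k.+1 + 2 = 2 * k + 2 + 2)%N by lia.
by rewrite exprD xy xz; ring.
Qed.

Lemma eisenstein_norm_exact (p t k : nat) (c : int) :
  prime p -> (p = 2 %[mod 3])%N -> ~~ (p %| c)%Z ->
  3 * k%:Z + 1 = p%:Z ^+ (2 * t + 1) * c -> ~ eisenstein_norm k.
Proof.
move=> pP p2 pc kE [u [v uv]].
apply: (@exact_odd_power_not_represented p t (fun u v => u ^+ 2 - u * v + v ^+ 2) c pP _ _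
  pc u v).
- by move=> x y; apply: dvd_eisenstein_form.
- by move=> a x y; ring.
- by rewrite -uv -kE.
Qed.

Lemma dvdz_coprime_factor (p a : nat) (x y : int) : prime p -> ~~ (p %| a)%N ->
  (p %| p%:Z * x + a%:Z * y)%Z -> (p %| y)%Z.
Proof.
move=> pP pa; rewrite rpredDl; last exact: dvdz_mulr.
rewrite Gauss_dvdzr //.
by rewrite coprimezE /= prime_coprime.
Qed.

(* The quotients by 3 and 4 are exact under the hypotheses on p. *)
Theorem theorem1p4 (n t : nat) :
  [/\ forall (p : nat) (j : int),
        prime p -> (p = 2 %[mod 3])%N -> (2 %| j)%Z -> ~~ (p%:Z %| j)%Z ->
        (B 3 12 (6 * p%:Z ^+ (2 * t + 2) * n%:Z
                 + (p%:Z ^+ (2 * t + 1) * (4 * p%:Z + 3 * j) - 1))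
         = 0 %[mod 6])%N,
      forall (p : nat) (j : int),
        prime p -> p <> 5%N -> (p = 2 %[mod 3])%N ->
        (2 %| j)%Z -> ~~ (p%:Z %| j)%Z ->
        (B 5 10 (10 * p%:Z ^+ (2 * t + 2) * n%:Z
                 + ((5 * (p%:Z ^+ (2 * t + 1) * (4 * p%:Z + 3 * j) - 1)) %/ 3)%Z)
         = 0 %[mod 10])%N
    & forall (alpha p : nat) (j : int),
        alpha \in [:: 1; 2; 3; 4]%N ->
        prime p -> p <> 3%N -> (p = 3 %[mod 4])%N ->
        (5 %| j)%Z -> ~~ (p%:Z %| j)%Z ->
        (B 3 15 (15 * p%:Z ^+ (2 * t + 2) * n%:Z
                 + ((p%:Z ^+ (2 * t + 1)
                     * ((12 * alpha%:Z + 5) * p%:Z + 12 * j) - 5) %/ 4)%Z)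
         = 0 %[mod 15])%N].
Proof.
have PX p : p%:Z ^+ (2 * t + 2) = p%:Z ^+ (2 * t + 1) * p%:Z by rewrite -exprSr addnS.
split.
- move=> p j pP p2 /dvdzP[j' jE] pj.
  (* m + 1 is p^(2t+1) times a factor prime to p, because p divides neither 3 nor j. *)
  set m := (X in B _ _ X);
    have mE : m = p%:Z ^+ (2 * t + 1) * (p%:Z * (6 * n%:Z + 4) + 3%:Z * j) - 1.
    by rewrite /m PX; ring.
  (* A negative argument is settled by the convention B = 0. *)
  case: m mE => [m|//] mE; apply/eqP; rewrite mod0n -/(6 %| _)%N (@Gauss_dvd 2 3) //.
  apply/andP; split.
    (* 12 = 2 * 6, and m is odd. *)
    apply: (@B_dvd_pow 2 3 6) => //; move: mE; rewrite jE; set X := _ ^+ _ => mE.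
    have : m%:Z = 2 * (X * (p%:Z * (3 * n%:Z + 2) + 3 * j')) - 1 by rewrite mE; ring.
    lia.
  (* 12 = 3 * 4 leads to E^8; if m = 3k then 3k + 1 = m + 1. *)
  apply: (@B_dvd_supported 3 4 eisenstein_norm) => // [A x N _|[k Sk mk]].
    exact: euler_prod8_eisenstein.
  apply: (@eisenstein_norm_exact p t k (p%:Z * (6 * n%:Z + 4) + 3%:Z * j) pP p2 _ _ Sk);
    last by rewrite -PoszM -mk mE subrK.
  apply: contra pj; apply: dvdz_coprime_factor => //.
  by rewrite dvdn_prime2 //; apply/eqP => p3; rewrite p3 in p2.
- move=> p j pP p5 p2 /dvdzP[j' jE] pj.
  have [z zE] : exists z, p%:Z ^+ (2 * t + 2) = 3 * z + 1.
    pose k := (p %/ 3)%N; have pk : p%:Z = 3 * k%:Z + 2 by rewrite /k; lia.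
    by apply: even_power_mod; exists (3 * k%:Z ^+ 2 + 4 * k%:Z + 1); rewrite pk; ring.
  set Y := p%:Z ^+ (2 * t + 1) * _.
  have [w wE] : exists w, Y = 3 * w + 1.
    exists (4 * z + 1 + p%:Z ^+ (2 * t + 1) * j).
    transitivity (4 * (p%:Z ^+ (2 * t + 2)) + 3 * (p%:Z ^+ (2 * t + 1) * j)).
      by rewrite PX /Y; ring.
    by rewrite zE; ring.
  have -> : (5 * (Y - 1) %/ 3)%Z = 5 * w by rewrite wE; lia.
  set m := (X in B _ _ X);
    have mE : 3 * m + 5 = 5 * (p%:Z ^+ (2 * t + 1) * (p%:Z * (6 * n%:Z + 4) + 3%:Z * j)).
    transitivity (5 * (6 * p%:Z ^+ (2 * t + 2) * n%:Z + (3 * w + 1))); first by rewrite /m;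
      ring.
    by rewrite -wE /Y PX; ring.
  case: m mE => [m|//] mE; apply/eqP; rewrite mod0n -/(10 %| _)%N (@Gauss_dvd 2 5) //.
  apply/andP; split.
    apply: (@B_dvd_pow 2 5 5) => //; move: mE; rewrite jE; set X := _ ^+ _ => mE.
    have : 3 * m%:Z + 5 = 2 * (5 * X * (p%:Z * (3 * n%:Z + 2) + 3 * j')) by rewrite mE; ring.
    lia.
  (* 10 = 5 * 2 leads again to E^8; if m = 5k, cancelling 5 leaves 3k + 1 = p^(2t+1) times the same
     cofactor as in (i). *)
  apply: (@B_dvd_supported 5 2 eisenstein_norm) => // [A x N _|[k Sk mk]].
    exact: euler_prod8_eisenstein.
  apply: (@eisenstein_norm_exact p t k (p%:Z * (6 * n%:Z + 4) + 3%:Z * j) pP p2 _ _ Sk);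
    last by move: mE; rewrite mk; lia.
  apply: contra pj; apply: dvdz_coprime_factor => //.
  by rewrite dvdn_prime2 //; apply/eqP => p3; rewrite p3 in p2.
- move=> alpha p j alE pP p3 p34 /dvdzP[j' jE] pj.
  have [z zE] : exists z, p%:Z ^+ (2 * t + 2) = 4 * z + 1.
    pose k := (p %/ 4)%N; have pk : p%:Z = 4 * k%:Z + 3 by rewrite /k; lia.
    by apply: even_power_mod; exists (4 * k%:Z ^+ 2 + 6 * k%:Z + 2); rewrite pk; ring.
  set Y := p%:Z ^+ (2 * t + 1) * _.
  have YE : Y = (12 * alpha%:Z + 5) * p%:Z ^+ (2 * t + 2) + 12 * (p%:Z ^+ (2 * t + 1) * j).
    by rewrite /Y PX; ring.
  have [w wE] : exists w, Y - 5 = 4 * w.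
    exists ((12 * alpha%:Z + 5) * z + 3 * alpha%:Z + 3 * (p%:Z ^+ (2 * t + 1) * j)).
    by rewrite YE zE; ring.
  have -> : ((Y - 5) %/ 4)%Z = w by rewrite wE; lia.
  set m := (X in B _ _ X).
  have mE : 4 * m + 5 = 60 * (p%:Z ^+ (2 * t + 2) * n%:Z) + Y.
    by rewrite /m mulrDr -wE; ring.
  case: m mE => [m|//] mE; apply/eqP; rewrite mod0n -/(15 %| _)%N (@Gauss_dvd 3 5) //.
  apply/andP; split; last first.
    (* 15 = 5 * 3; modulo 5, 4m is 2 alpha p^(2t+2), which is nonzero as p is not 5. *)
    apply: (@B_dvd_pow 5 3 3) => //; apply/negP => /dvdnP[k mk].
    have p5 : ~~ (5 %| p)%N by rewrite dvdn_prime2 //; apply/eqP => p5; rewrite -p5 in p34.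
    have : ~~ (5 %| p%:Z ^+ (2 * t + 2))%Z by rewrite dvdzE abszX Euclid_dvdX // negb_and p5.
    have {mE} : 4 * (k * 5)%N%:Z + 5 = 60 * (p%:Z ^+ (2 * t + 2) * n%:Z)
        + ((12 * alpha%:Z + 5) * p%:Z ^+ (2 * t + 2) + 60 * (p%:Z ^+ (2 * t + 1) * j')).
      by rewrite -mk mE YE jE; ring.
    move: (_ * j') => U; move: (_ * n%:Z) => Q; move: (p%:Z ^+ _) => P.
    by move: alE; rewrite !inE => /or4P[] /eqP ->; lia.
  (* 15 = 3 * 5 leads to E^10; if m = 3k then 24k + 10 = 2 (4m + 5). *)
  apply: (@B_dvd_supported 3 5 (fun n => exists x y : int, 24 * n%:Z + 10 = x ^+ 2 + y ^+
    2)) => //.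
    move=> A x N A3 xN; exact: euler_prod10_two_squares xN A3.
  move=> [k [x [y xy]] mk].
  apply: (@exact_odd_power_not_represented p t (fun u v => u ^+ 2 + v ^+ 2)
    (p%:Z * (120 * n%:Z + 24 * alpha%:Z + 10) + 24%:Z * j) pP _ _ _ x y).
  + by move=> u v; apply: dvd_sum_squares.
  + by move=> a u v; ring.
  + apply: contra pj; apply: dvdz_coprime_factor => //.
    rewrite (_ : 24 = 2 * (2 * (2 * 3)))%N // !Euclid_dvdM // !dvdn_prime2 //.
    by apply/negP => /or4P[] /eqP // p2; rewrite p2 in p34.
  rewrite -xy; transitivity (2 * (4 * m%:Z + 5)); first by rewrite mk PoszM; ring.
  by rewrite mE YE PX; ring.
Qed.
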